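(* Let $a=(a_i)_{i\in\mathbb Z}$ be a sequence in $\Bbbk$. Let $\lambda$ be a partition given in Frobenius notation as $(\beta_1,\ldots,\beta_k\,|\,\alpha_1,\ldots,\alpha_k)$. Then $$\breve S_{\lambda;a}=|G|_{kk},\qquad G=\bigl(\breve S_{(\beta_p|\alpha_q);a}\bigr)_{1\le p,q\le k},$$ i.e. $\breve S_{\lambda;a}$ is the quasideterminant, with respect to the bottom right entry, of the $k\times k$ matrix whose $(p,q)$ entry is the quasi-Schur function of the hook $(\beta_p|\alpha_q)$.
   Context: $\Bbbk$ is a field of characteristic zero and $a=(a_i)_{i\in\mathbb Z}$ is a sequence in $\Bbbk$. Put $(t\downarrow a)^k=(t-a_1)\cdots(t-a_k)$, $(t\downarrow a)^0=1$, and $(\tau^s a)_i=a_{i+s}$ for $s\in\mathbb Z$. $\mathrm{Sym}^a=\Bbbk\langle S_{1;a},S_{2;a},\ldots\rangle$ is the free associative unital $\Bbbk$-algebra on $S_{k;a}$, $k\ge1$; computations take place in the free skew field generated by $S_{1;a},S_{2;a},\ldots$ (the universal field of fractions of $\mathrm{Sym}^a$). Conventions: $S_{0;a}=1$. Shifts: for $s\in\mathbb Z$, $S_{k;a}^{[s]}\in \mathrm{Sym}^a$ is defined by $\sum_{k\ge0} S_{k;a}^{[s]}/(t\downarrow\tau^{-s}a)^k=\sum_{k\ge0}S_{k;a}/(t\downarrow a)^k$ (formal power series in $1/t$, $t$ central), and $S_{-k;a}^{[s]}=0$ for $k>0$. Quasideterminants: for an $n\times n$ matrix $A$ over a skew field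 such that the matrix $A^{pq}$ (delete row $p$ and column $q$) is invertible, $|A|_{pq}=a_{pq}-r(A^{pq})^{-1}c$, where $r$ is the $p$-th row of $A$ with $a_{pq}$ removed and $c$ is the $q$-th column of $A$ with $a_{pq}$ removed. Multiparameter quasi-Schur functions: for a partition $\lambda=(\lambda_1\le\lambda_2\le\cdots\le\lambda_n)$ with positive parts, $\breve S_{\lambda;a}=(-1)^{n-1}|A|_{1n}$, where $A$ is the $n\times n$ matrix with entries $A_{pq}=S_{\lambda_q+q-p;a}^{[n-p]}$. Frobenius notation: $(\beta|\alpha)$ denotes the hook partition $(1^\beta,\alpha+1)$. For a general partition $\lambda$, decompose its diagram into its diagonal hooks $(\beta_p|\alpha_p)$, $p=1,\ldots,k$ ($\alpha_p$ and $\beta_p$ being the arm and leg lengths of the diagonal boxes); the hooks are listed in increasing order, so $0\le\alpha_1<\cdots<\alpha_k$ and $0\le\beta_1<\cdots<\beta_k$. *)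

(* Defs.v *)
From Stdlib Require Import ClassicalEpsilon.
From HB Require Import structures.
From mathcomp Require Import all_boot all_order all_algebra.
From mathcomp Require Import monalg.

Set Implicit Arguments.
Unset Strict Implicit.
Unset Printing Implicit Defensive.

Import GRing.Theory.
Local Open Scope ring_scope.

(* Skew fields are unit rings [K] satisfying [GRing.field_axiom K] (every
   nonzero element is a unit; commutativity is not part of that axiom). *)

(* Cohn's notions of an epic R-field, of a specialization between R-fields and
   of a universal field of fractions of R. *)

Section SkewFieldsOfFractions.
Variable R : nzRingType.

Record epic_field (K : unitRingType) (psi : {rmorphism R -> K}) : Prop :=
  EpicField {
  epic_field_axiom : GRing.field_axiom K;
  epic_field_generated : forall P : K -> Prop,
    (forall r, P (psi r)) ->
    (forall x y, P x -> P y -> P (x - y)) ->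
    (forall x y, P x -> P y -> P (x * y)) ->
    (forall x, P x -> P x^-1) ->
    forall x, P x
}.

(* Only the restriction of the total function [f] to the subring [L] matters.
   Between epic fields a specialization is unique, up to agreement on a common
   smaller domain. *)
Record specialization (U K : unitRingType) (phi : {rmorphism R -> U})
    (psi : {rmorphism R -> K}) (L : U -> Prop) (f : U -> K) : Prop :=
  Specialization {
  spec_dom_base : forall r, L (phi r);
  spec_dom_sub : forall x y, L x -> L y -> L (x - y);
  spec_dom_mul : forall x y, L x -> L y -> L (x * y);
  spec_base : forall r, f (phi r) = psi r;
  spec_add : forall x y, L x -> L y -> f (x + y) = f x + f y;
  spec_mul : forall x y, L x -> L y -> f (x * y) = f x * f y;
  spec_local : forall x, L x -> f x != 0 -> L x^-1
}.

Record universal_field_of_fractions (U : unitRingType)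
    (phi : {rmorphism R -> U}) : Prop := UniversalFieldOfFractions {
  ufrac_epic : epic_field phi;
  ufrac_inj : injective phi;
  ufrac_universal : forall (K : unitRingType) (psi : {rmorphism R -> K}),
    epic_field psi -> exists L f, specialization phi psi L f
}.

End SkewFieldsOfFractions.

Section Quasideterminants.
Variable D : unitRingType.

Definition mx_inverse n (A B : 'M[D]_n) : Prop :=
  A *m B = 1%:M /\ B *m A = 1%:M.

Definition mx_invertible n (A : 'M[D]_n) : Prop := exists B, mx_inverse A B.

(* [invmx] requires commutative coefficients. *)
Definition mxinv n (A : 'M[D]_n) : 'M[D]_n :=
  epsilon (inhabits 0) (mx_inverse A).

Definition quasidet_defined n (A : 'M[D]_n) (p q : 'I_n) : Prop :=
  mx_invertible (row' p (col' q A)).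

Definition quasidet n (A : 'M[D]_n) (p q : 'I_n) : D :=
  A p q - (row p (col' q A) *m mxinv (row' p (col' q A))
             *m col q (row' p A)) 0 0.

End Quasideterminants.

Lemma mxinvP (D : unitRingType) n (A : 'M[D]_n) :
  mx_invertible A -> mx_inverse A (mxinv A).
Proof. exact: epsilon_spec. Qed.

(* Formal power series in 1/t are given by their coefficients: [f m] is the
   coefficient of t^(-m). *)

Section FallingSeries.
Variable F : fieldType.
Implicit Types (b : int -> F) (c : F).

Definition tau (s : int) b : int -> F := fun i => b (i + s).

Definition series_mul (f g : nat -> F) : nat -> F :=
  fun m => \sum_(i < m.+1) f i * g (m - i)%N.

(* 1 / (t - c) *)
Definition inv_linear c : nat -> F := fun m => if m is j.+1 then c ^+ j else 0.

(* 1 / ((t - b_1) ... (t - b_k)) *)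
Fixpoint inv_falling b (k : nat) : nat -> F :=
  if k is j.+1 then series_mul (inv_falling b j) (inv_linear (b j.+1%:Z))
  else fun m => (m == 0%N)%:R.

(* \sum_(k >= 0) u_k / (t |v b)^k; the terms with k > m have no t^(-m). *)
Definition falling_series (M : lmodType F) b (u : nat -> M) : nat -> M :=
  fun m => \sum_(k < m.+1) inv_falling b k m *: u k.

(* The first [m] coefficients in the expansion of [f] along the
   1 / (t |v b)^k, obtained by solving a unitriangular system. *)
Fixpoint falling_coefs (M : lmodType F) b (f : nat -> M) (m : nat) : seq M :=
  if m is j.+1 then
    let s := falling_coefs b f j in
    rcons s (f j - \sum_(k < j) inv_falling b k j *: s`_k)
  else [::].

Definition falling_coef (M : lmodType F) b (f : nat -> M) (m : nat) : M :=
  (falling_coefs b f m.+1)`_m.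

Lemma series_mul_inv_linear (f : nat -> F) c m :
  series_mul f (inv_linear c) m.+1 - c * series_mul f (inv_linear c) m = f m.
Proof.
rewrite /series_mul big_ord_recr /= subnn mulr0 addr0.
rewrite big_ord_recr /= subSn // subnn /= expr0 mulr1 [X in c * X]big_ord_recr /=.
rewrite subnn mulr0 addr0 addrAC mulr_sumr -sumrB big1 ?add0r // => i _.
by rewrite subSn 1?ltnW //= -[(m - i)%N]prednK ?subn_gt0 //= exprS mulrCA subrr.
Qed.

Lemma inv_falling_small b k m : (m < k)%N -> inv_falling b k m = 0.
Proof.
elim: k m => // k IHk m; rewrite ltnS => le_mk /=.
rewrite /series_mul big_ord_recr /= subnn mulr0 addr0 big1 // => i _.
by rewrite IHk ?mul0r //; exact: leq_trans le_mk.
Qed.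

Lemma inv_falling_diag b k : inv_falling b k k = 1.
Proof.
elim: k => //= k IHk; rewrite /series_mul big_ord_recr /= subnn mulr0 addr0.
rewrite big_ord_recr /= subSn // subnn /= expr0 mulr1 IHk big1 ?add0r // => i _.
by rewrite inv_falling_small ?mul0r.
Qed.

Lemma size_falling_coefs (M : lmodType F) b (f : nat -> M) m :
  size (falling_coefs b f m) = m.
Proof. by elim: m => //= m IHm; rewrite size_rcons IHm. Qed.

Lemma nth_falling_coefs (M : lmodType F) b (f : nat -> M) m k :
  (k < m)%N -> (falling_coefs b f m)`_k = falling_coef b f k.
Proof.
elim: m => // m IHm; rewrite ltnS leq_eqVlt => /predU1P[-> //|lt_km] /=.
by rewrite nth_rcons size_falling_coefs lt_km IHm.
Qed.

Lemma falling_coefE (M : lmodType F) b (f : nat -> M) m :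
  falling_coef b f m =
  f m - \sum_(k < m) inv_falling b k m *: falling_coef b f k.
Proof.
rewrite {1}/falling_coef /= nth_rcons size_falling_coefs ltnn eqxx.
by congr (_ - _); apply: eq_bigr => k _; rewrite nth_falling_coefs.
Qed.

Lemma falling_coefP (M : lmodType F) b (f u : nat -> M) :
  falling_series b u =1 f <-> u =1 falling_coef b f.
Proof.
split=> [uP|uE m]; last first.
  rewrite /falling_series big_ord_recr /= inv_falling_diag scale1r uE.
  rewrite falling_coefE /=.
  by under eq_bigr => k _ do rewrite uE; rewrite addrC subrK.
elim/ltn_ind => m IHm; rewrite falling_coefE -uP.
rewrite /falling_series big_ord_recr /= inv_falling_diag scale1r addrC.
by rewrite (eq_bigr _ (fun (k : 'I_m) _ => congr1 _ (IHm k (ltn_ord k)))) addrK.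
Qed.

End FallingSeries.

(* The free associative algebra on S_1, S_2, ...; letter [j] is S_(j+1). *)
Notation Sym F := {malg F[{fmonom nat}]}.

Section QuasiSchur.
Variables (F : fieldType) (a : int -> F).

Definition gen_S (k : nat) : Sym F := if k is j.+1 then << fmu j >> else 1.

Definition shifted_S (s : int) (k : nat) : Sym F :=
  falling_coef (tau (- s) a) (falling_series a gen_S) k.

Lemma shifted_SP (s : int) :
  falling_series (tau (- s) a) (shifted_S s) =1 falling_series a gen_S.
Proof. by apply/falling_coefP. Qed.

Lemma shifted_S_unique (s : int) (u : nat -> Sym F) :
  falling_series (tau (- s) a) u =1 falling_series a gen_S ->
  u =1 shifted_S s.
Proof. by move/falling_coefP. Qed.

Definition shifted_Sz (s k : int) : Sym F :=
  if k is Posz m then shifted_S s m else 0.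

Variables (D : unitRingType) (phi : {rmorphism Sym F -> D}).

(* Rows and columns are numbered from 0, so that [q - p] is unaffected while
   the shift (n+1) - (p+1) of row [p] becomes [n - p]. *)
Definition schur_mx n (lam : n.+1.-tuple nat) : 'M[D]_n.+1 :=
  \matrix_(p, q)
    phi (shifted_Sz (n%:Z - p%:Z) ((tnth lam q)%:Z + q%:Z - p%:Z)).

Definition quasi_schur_defined n (lam : n.+1.-tuple nat) : Prop :=
  quasidet_defined (schur_mx lam) ord0 ord_max.

Definition quasi_schur n (lam : n.+1.-tuple nat) : D :=
  (-1) ^+ n * quasidet (schur_mx lam) ord0 ord_max.

End QuasiSchur.

Definition is_partition n (lam : n.-tuple nat) : bool :=
  sorted leq lam && all (leq 1) lam.

Definition hook (b c : nat) : b.+1.-tuple nat := [tuple of rcons (nseq b 1%N) c.+1].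

(* Rows and columns of the diagram are numbered from 0, longest row first, so
   that the [d]-th diagonal box is present iff [d < row_len lam d]. *)
Definition row_len (lam : seq nat) (i : nat) : nat := nth 0%N (rev lam) i.
Definition col_len (lam : seq nat) (j : nat) : nat := count (ltn j) lam.
Definition diag_len (lam : seq nat) : nat :=
  count (fun d => d < row_len lam d)%N (iota 0 (size lam)).
Definition arm (lam : seq nat) (d : nat) : nat := (row_len lam d - d.+1)%N.
Definition leg (lam : seq nat) (d : nat) : nat := (col_len lam d - d.+1)%N.

(* The hooks are listed in increasing order, so the [p]-th one is attached to
   the diagonal box [k - p] (of boxes 0, ..., k). *)
Definition frobenius n (lam : n.-tuple nat) k (beta alpha : k.+1.-tuple nat) :
    Prop :=
  [/\ diag_len lam = k.+1,
      forall p : 'I_k.+1, tnth beta p = leg lam (k - p)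
    & forall p : 'I_k.+1, tnth alpha p = arm lam (k - p)].

Definition giambelli_mx (F : fieldType) (a : int -> F) (D : unitRingType)
    (phi : {rmorphism Sym F -> D}) k (beta alpha : k.+1.-tuple nat) :
    'M[D]_k.+1 :=
  \matrix_(p, q) quasi_schur a phi (hook (tnth beta p) (tnth alpha q)).

(* Main.v *)
Require Import Defs.
From HB Require Import structures.
From mathcomp Require Import all_boot all_order all_algebra.
From mathcomp Require Import monalg zify.
Import GRing.Theory.
Local Open Scope ring_scope.

(** Both sides are quasideterminants, and a quasideterminant [|A|_pq] is the
    inverse of the entry [(q, p)] of the inverse matrix ([quasidet_inverse]).
    So it is enough to compare one corner of two inverse matrices.

    Let [N] be the number of parts of [lam], and consider the infinite
    Jacobi-Trudi array with [N] rows whose column of index [m] consists of the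
    [S_(m-i)^[N-1-i]].  The Jacobi-Trudi matrix of [lam] is made of the columns
    whose index is a beta-number [lam_q + q].  The first [N] columns form a
    unitriangular matrix.  Solving for the later columns in terms of these is a
    back-substitution, and a hook function is by definition one unknown of such
    a unitriangular system: the coordinates of column [N + c] are, up to signs,
    the functions of the hooks [(N-1-i|c)] ([base_mx_hooks]).  In this basis the
    matrix of [lam] therefore has two kinds of columns.  A beta-number less than
    [N] gives a unit vector.  The other beta-numbers are the [N + alpha_q], and
    give columns of hook functions.  The rows not hit by the unit vectors are
    those of index [N-1-beta_p]; after a permutation of the rows the matrix is
    block triangular, with an identity block and the Giambelli matrix up to
    signs ([block_reduced]).  Inverting the blocks matches the corners of the two
    inverses ([schur_mx_inverse]).

    What is left is to see that the quasideterminants are defined, which reduces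
    to the invertibility of the Giambelli matrix and of its minor
    ([hook_matrix_invertible]).  Here the universality of the skew field is used:
    a specialization to the base field is defined on a local ring, so that a
    matrix becomes invertible over the skew field as soon as its leading blocks
    are invertible at some point of the free algebra ([lift_leading_inverse]).
    Such a point is found by induction ([regular_point]): the hook [(b|c)] is
    [S_(b+c+1)], up to a sign, plus a polynomial in generators of smaller index,
    so the bottom right entry of each leading block involves a coordinate of the
    point that no other entry of the block involves. *)

Set Implicit Arguments.
Unset Strict Implicit.
Unset Printing Implicit Defensive.

(** * Inverse matrices and quasideterminants over a noncommutative ring *)

Section Inverses.
Variable D : unitRingType.

Lemma mx_inverse_uniq n (A B C : 'M[D]_n) :
  mx_inverse A B -> mx_inverse A C -> B = C.
Proof.
move=> [_ BA1] [AC1 _].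
by rewrite -[B]mulmx1 -AC1 mulmxA BA1 mul1mx.
Qed.

Lemma mx_inverse_mul n (A A' B B' : 'M[D]_n) :
  mx_inverse A A' -> mx_inverse B B' -> mx_inverse (A *m B) (B' *m A').
Proof.
move=> [AA' A'A] [BB' B'B]; split.
  by rewrite mulmxA -[A *m B *m B']mulmxA BB' mulmx1.
by rewrite mulmxA -[B' *m A' *m A]mulmxA A'A mulmx1.
Qed.

(** The equation [A *m B = 1] splits into blocks when one outer index, [p], and
    one summation index, [q], are set apart; the blocks are those in which the
    quasideterminant [|A|_pq] is written. *)
Lemma mulmx1_blocks n (A B : 'M[D]_n) (p q : 'I_n) : A *m B = 1%:M ->
  [/\ row' p (col' q A) *m row' q (col' p B)
        + col q (row' p A) *m row q (col' p B) = 1%:M,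
      row' p (col' q A) *m col p (row' q B)
        + col q (row' p A) *m (B q p)%:M = 0,
      row p (col' q A) *m row' q (col' p B)
        + (A p q)%:M *m row q (col' p B) = 0
    & row p (col' q A) *m col p (row' q B) + (A p q)%:M *m (B q p)%:M = 1%:M].
Proof.
move=> AB1.
have AB1E i j : \sum_l A i (lift q l) * B (lift q l) j + A i q * B q j
    = (i == j)%:R.
  by have /matrixP/(_ i j) := AB1; rewrite !mxE (bigD1_ord q) //= addrC.
split; apply/matrixP=> i j; rewrite !mxE ?ord1 ?eqxx ?mulr1n.
- under eq_bigr => l _ do rewrite !mxE.
  by rewrite big_ord1 !mxE AB1E (inj_eq lift_inj).
- under eq_bigr => l _ do rewrite !mxE.
  by rewrite big_ord1 !mxE ord1 eqxx mulr1n AB1E eq_sym (negPf (neq_lift _ _)).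
- under eq_bigr => l _ do rewrite !mxE.
  by rewrite big_ord1 !mxE ord1 eqxx mulr1n AB1E (negPf (neq_lift _ _)).
- under eq_bigr => l _ do rewrite !mxE.
  by rewrite big_ord1 !mxE ord1 eqxx !mulr1n AB1E eqxx.
Qed.

Lemma scalar11_mul (x y : D) : (x%:M : 'M_1) *m y%:M = (x * y)%:M.
Proof.
by apply/matrixP=> i j; rewrite !mxE big_ord1 !mxE !ord1 eqxx !mulr1n.
Qed.

(** When the entry [B q p] of the inverse is a unit, its Schur complement in [B]
    is an inverse of the complementary minor of [A]; substituting it in the
    definition of the quasideterminant leaves [(B q p)^-1]. *)
Lemma quasidet_inverse n (A B : 'M[D]_n) (p q : 'I_n) :
  mx_inverse A B -> B q p \is a GRing.unit ->
  quasidet_defined A p q /\ quasidet A p q = (B q p)^-1.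
Proof.
move=> [AB1 BA1] Ue.
have [m1 m2 m3 m4] := mulmx1_blocks p q AB1.
have [k1 k2 k3 k4] := mulmx1_blocks q p BA1.
rewrite /quasidet_defined /quasidet.
set M := row' p (col' q A) in m1 m2 k1 k3 *.
set r := row p (col' q A) in m3 m4 k1 k3 *.
set c := col q (row' p A) in m1 m2 k2 k4 *.
move: (row' q (col' p B)) (row q (col' p B)) (col p (row' q B))
  m1 m2 m3 m4 k1 k2 k3 k4 => N s t.
set e := (B q p)%:M; set d := (A p q)%:M => m1 m2 m3 m4 k1 k2 k3 k4.
pose e' : 'M_1 := (B q p)^-1%:M.
have ee' : e *m e' = 1%:M by rewrite scalar11_mul divrr.
have e'e : e' *m e = 1%:M by rewrite scalar11_mul mulVr.
pose V := N - t *m e' *m s.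
have MV : mx_inverse M V.
  split.
    rewrite /V mulmxBr !mulmxA (canRL (addrK _) m1) (canRL (addrK _) m2) sub0r.
    by rewrite !mulNmx -(mulmxA c e e') ee' mulmx1 opprK subrK.
  rewrite /V mulmxBl -!mulmxA (canRL (addrK _) k1) (canRL (addrK _) k3) sub0r.
  by rewrite mulmxN (mulmxA e' e) e'e mul1mx mulmxN opprK subrK.
have Mi : mx_invertible M by exists V.
split=> //; rewrite -(mx_inverse_uniq MV (mxinvP Mi)).
have Vc : V *m c = - (t *m e').
  rewrite /V mulmxBl -!mulmxA (canRL (addrK _) k2) (canRL (addrK _) k4) sub0r.
  by rewrite !mulmxBr mulmx1 (mulmxA e' e) e'e mul1mx opprB addrA addNr sub0r.
have -> : r *m V *m c = d - e'.
  rewrite -mulmxA Vc mulmxN mulmxA (canRL (addrK _) m4) mulmxBl mul1mx.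
  by rewrite -mulmxA ee' mulmx1 opprB.
by rewrite !mxE eqxx !mulr1n subKr.
Qed.

(** Were this entry zero, the rest of its row in [B] would be annihilated by an
    invertible minor, so that [B] would have a zero row. *)
Lemma inverse_entry_neq0 n (A B : 'M[D]_n) (p q : 'I_n) :
  mx_inverse A B -> quasidet_defined A p q -> B q p != 0.
Proof.
move=> [AB1 BA1] [V [MV _]]; apply/eqP=> Bqp0.
have [_ _ k3 k4] := mulmx1_blocks q p BA1.
move: k3 k4; rewrite Bqp0 raddf0 !mul0mx !addr0 => sM0.
have -> : row q (col' p B) = 0 by rewrite -[LHS]mulmx1 -MV mulmxA sM0 mul0mx.
rewrite mul0mx => /matrixP/(_ 0 0)/eqP; rewrite !mxE eqxx eq_sym.
by rewrite (negPf (oner_neq0 D)).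
Qed.

Lemma mx_inverse_mxsub m n (f g : 'I_m -> 'I_n) (f' g' : 'I_n -> 'I_m)
    (A : 'M[D]_n) (V : 'M[D]_m) :
  cancel f f' -> cancel f' f -> cancel g g' -> cancel g' g ->
  mx_inverse (mxsub f g A) V -> mx_inverse A (mxsub g' f' V).
Proof.
move=> fK f'K gK g'K [AV VA]; split; apply/matrixP=> i j; rewrite !mxE.
  have /matrixP/(_ (f' i) (f' j)) := AV; rewrite !mxE (can_eq f'K) => <-.
  rewrite (reindex g) /=; last by exists g' => l _.
  by apply: eq_bigr => l _; rewrite !mxE f'K gK.
have /matrixP/(_ (g' i) (g' j)) := VA; rewrite !mxE (can_eq g'K) => <-.
rewrite (reindex f) /=; last by exists f' => l _.
by apply: eq_bigr => l _; rewrite !mxE g'K fK.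
Qed.

Lemma mx_inverse_ublock m n (X : 'M[D]_(m, n)) (A A' : 'M[D]_m)
    (B B' : 'M[D]_n) :
  mx_inverse A A' -> mx_inverse B B' ->
  mx_inverse (block_mx A X 0 B) (block_mx A' (- (A' *m X *m B')) 0 B').
Proof.
move=> [AA' A'A] [BB' B'B].
split; rewrite mulmx_block scalar_mx_block; congr block_mx;
  rewrite ?(mulmx0, mul0mx, addr0, add0r) //.
  by rewrite mulmxN !mulmxA AA' mul1mx addNr.
by rewrite mulNmx -!mulmxA B'B mulmx1 subrr.
Qed.

Lemma unitriangular_invertible n (U : 'M[D]_n) :
  (forall i j : 'I_n, (j < i)%N -> U i j = 0) -> (forall i, U i i = 1) ->
  mx_invertible U.
Proof.
elim: n U => [|n IHn] U U0 U1.
  by exists 0; split; apply/matrixP=> [[]].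
move: (U : 'M_(1 + n)) U0 U1 => {U} U U0 U1.
have [|i|V UV] := IHn (drsubmx U).
- by move=> i j lt_ji; rewrite !mxE U0 //= ltn_add2l.
- by rewrite !mxE U1.
have ulE : ulsubmx U = 1%:M.
  by apply/matrixP=> i j; rewrite !mxE !ord1 /= U1.
have dlE : dlsubmx U = 0.
  by apply/matrixP=> i j; rewrite !mxE U0 //= ord1.
rewrite -(submxK U) ulE dlE.
have I1 : mx_inverse (1%:M : 'M[D]_1) 1%:M by split; rewrite mulmx1.
by eexists; exact: (mx_inverse_ublock (ursubmx U) I1 UV).
Qed.

Lemma mx_inverse_schur m (A A' : 'M[D]_m) (b : 'cV_m) (c : 'rV_m) (d z : D) :
  mx_inverse A A' -> d%:M - c *m A' *m b = z%:M -> z \is a GRing.unit ->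
  mx_inverse (block_mx A b c d%:M)
    (block_mx (A' + A' *m b *m z^-1%:M *m c *m A') (- (A' *m b *m z^-1%:M))
       (- (z^-1%:M *m c *m A')) z^-1%:M).
Proof.
move=> [AA' A'A] dE Uz.
have zz' : z%:M *m z^-1%:M = 1%:M :> 'M_1 by rewrite scalar11_mul divrr.
have z'z : z^-1%:M *m z%:M = 1%:M :> 'M_1 by rewrite scalar11_mul mulVr.
move: {Uz}(z^-1%:M : 'M_1) zz' z'z => z' zz' z'z.
have {}dE : d%:M = z%:M + c *m A' *m b by rewrite -dE subrK.
split; rewrite mulmx_block scalar_mx_block dE.
  congr block_mx.
  - by rewrite mulmxDr mulmxN !mulmxA AA' mul1mx addrK.
  - by rewrite mulmxN !mulmxA AA' mul1mx addNr.
  - rewrite mulmxDr mulmxN !mulmxA mulmxDl zz' !mulmxDl mul1mx.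
    by rewrite subrr.
  - by rewrite mulmxN !mulmxA mulmxDl zz' addrC addrK.
congr block_mx.
- by rewrite mulmxDl mulNmx -!mulmxA A'A mulmx1 addrK.
- rewrite mulmxDl mulNmx mulmxDr -!mulmxA z'z mulmx1.
  by rewrite opprD addrACA subrr add0r subrr.
- by rewrite mulNmx -!mulmxA A'A mulmx1 addNr.
- by rewrite mulNmx mulmxDr z'z !mulmxA addrC addrK.
Qed.

End Inverses.

(** * Lifting invertibility along a specialization *)

(** Entries indexed by [nat] let the blocks of all sizes share one family. *)
Definition leading (T : nzRingType) (g : nat -> nat -> T) m : 'M[T]_m :=
  \matrix_(i, j) g i j.

Lemma leading_block (T : nzRingType) (g : nat -> nat -> T) m :
  leading g (m + 1)
    = block_mx (leading g m) (\col_i g i m) (\row_j g m j) (g m m)%:M.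
Proof.
apply/matrixP=> i j; rewrite -[i]splitK -[j]splitK.
case: (split i) => i'; case: (split j) => j' /=.
- by rewrite block_mxEul !mxE.
- by rewrite block_mxEur !mxE /= ord1 addn0.
- by rewrite block_mxEdl !mxE /= ord1 addn0.
- by rewrite block_mxEdr !mxE /= !ord1 eqxx !addn0.
Qed.

Section Lifting.
Variables (R : nzRingType) (U : unitRingType) (F : fieldType).
Variables (phi : {rmorphism R -> U}) (psi : {rmorphism R -> F}).
Hypothesis Dfield : GRing.field_axiom U.
Variables (L : U -> Prop) (f : U -> F).
Hypothesis fP : specialization phi psi L f.

Let LB := spec_dom_sub fP.
Let LM := spec_dom_mul fP.
Let fD := spec_add fP.
Let fM := spec_mul fP.

Lemma spec_dom0 : L 0.
Proof. by rewrite -(rmorph0 phi); exact: spec_dom_base fP 0. Qed.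

Lemma spec0 : f 0 = 0.
Proof. by rewrite -(rmorph0 phi) (spec_base fP) rmorph0. Qed.

Lemma spec_domN x : L x -> L (- x).
Proof. by move=> Lx; rewrite -sub0r; apply: LB => //; exact: spec_dom0. Qed.

Lemma spec_domD x y : L x -> L y -> L (x + y).
Proof.
by move=> Lx Ly; rewrite -[y]opprK; apply: LB => //; exact: spec_domN.
Qed.

Lemma specN x : L x -> f (- x) = - f x.
Proof.
move=> Lx; apply/eqP; rewrite -addr_eq0 -fD ?addNr ?spec0 //.
exact: spec_domN.
Qed.

Lemma specB x y : L x -> L y -> f (x - y) = f x - f y.
Proof. by move=> Lx Ly; rewrite fD ?specN //; exact: spec_domN. Qed.

Lemma spec_sum (I : Type) (s : seq I) (P : pred I) (E : I -> U) :
  (forall i, L (E i)) ->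
  L (\sum_(i <- s | P i) E i) /\
  f (\sum_(i <- s | P i) E i) = \sum_(i <- s | P i) f (E i).
Proof.
move=> LE; elim: s => [|i s [Ls fs]]; last first.
  rewrite !big_cons; case: ifP => // _.
  by rewrite fD // fs; split=> //; exact: spec_domD.
by rewrite !big_nil spec0; split=> //; exact: spec_dom0.
Qed.

Lemma spec_mulmx m n p (A : 'M[U]_(m, n)) (B : 'M[U]_(n, p)) :
  (forall i j, L (A i j)) -> (forall i j, L (B i j)) ->
  (forall i j, L ((A *m B) i j)) /\
  map_mx f (A *m B) = map_mx f A *m map_mx f B.
Proof.
move=> LA LB'.
have LAB i j l : L (A i j * B j l) by exact: LM.
split=> [i j|]; first by rewrite mxE; apply: (spec_sum _ _ _).1.
apply/matrixP=> i j; rewrite !mxE (spec_sum _ _ _).2 //.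
by apply: eq_bigr => l _; rewrite !mxE fM.
Qed.

Lemma spec_dom_block m n p q (A : 'M[U]_(m, n)) (B : 'M[U]_(m, p))
    (C : 'M[U]_(q, n)) (E : 'M[U]_(q, p)) :
  (forall i j, L (A i j)) -> (forall i j, L (B i j)) ->
  (forall i j, L (C i j)) -> (forall i j, L (E i j)) ->
  forall i j, L (block_mx A B C E i j).
Proof.
move=> LA LB' LC LE i j; rewrite -[i]splitK -[j]splitK.
case: (split i) => i'; case: (split j) => j' /=.
- by rewrite block_mxEul.
- by rewrite block_mxEur.
- by rewrite block_mxEdl.
- by rewrite block_mxEdr.
Qed.

(** The domain of a specialization is a local ring: an element with a nonzero
    value is inverted in it.  So elimination without pivoting succeeds there as
    soon as it succeeds on the values, which is what nonsingular leading blocks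
    ensure. *)
Lemma lift_leading_inverse (g : nat -> nat -> U) m :
  (forall i j, L (g i j)) ->
  (forall k, (k <= m)%N -> leading (fun i j => f (g i j)) k \in unitmx) ->
  exists B, mx_inverse (leading g m) B /\ forall i j, L (B i j).
Proof.
move=> Lg; elim: m => [|m IHm] Um.
  by exists 0; split=> [|[]//]; split; apply/matrixP=> [[]].
have [k le_km|A' [AA' LA']] := IHm; first by apply: Um; exact: leqW.
have := Um m.+1 (leqnn _); rewrite -addn1 !leading_block.
set c := \row_j g m j; set b := \col_i g i m; set A := leading g m.
have Lb i j : L (b i j) by rewrite mxE.
have Lc i j : L (c i j) by rewrite mxE.
have LA i j : L (A i j) by rewrite mxE.
have [LcA' fcA'] := spec_mulmx Lc LA'.
have [LcA'b fcA'b] := spec_mulmx LcA' Lb.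
have [LA'b _] := spec_mulmx LA' Lb.
have [_ fAA'] := spec_mulmx LA LA'.
pose z := g m m - (c *m A' *m b) 0 0.
have Lz : L z by apply: LB.
have zE : (g m m)%:M - c *m A' *m b = z%:M.
  apply/matrixP=> i j; rewrite !ord1 [LHS]mxE [X in X + _]mxE [X in _ + X]mxE.
  by rewrite [RHS]mxE eqxx !mulr1n.
move=> UF; have fz : f z != 0.
  apply/eqP; rewrite specB // => fz0.
  (* A vanishing Schur complement gives the kernel vector v. *)
  pose v := col_mx (- (map_mx f A' *m map_mx f b)) (1%:M : 'M_1).
  set M := block_mx _ _ _ _ in UF; suff Mv0 : M *m v = 0.
    have := mulKmx UF v; rewrite Mv0 mulmx0.
    move=> /(congr1 (@dsubmx _ _ _ _))/matrixP/(_ 0 0)/eqP.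
    by rewrite col_mxKd !mxE eqxx eq_sym (negPf (oner_neq0 F)).
  have fA : leading (fun i j => f (g i j)) m = map_mx f A.
    by apply/matrixP=> i j; rewrite !mxE.
  have fb : \col_i f (g i m) = map_mx f b by apply/matrixP=> i j; rewrite !mxE.
  have fc : \row_j f (g m j) = map_mx f c by apply/matrixP=> i j; rewrite !mxE.
  rewrite /M fA fb fc mul_block_col !mulmx1 !mulmxN !mulmxA -fAA' -fcA' -fcA'b.
  have -> : map_mx f (A *m A') = 1%:M.
    rewrite AA'.1; apply/matrixP=> i j; rewrite !mxE.
    by rewrite -!(rmorph_nat phi) (spec_base fP) rmorph_nat.
  rewrite mul1mx addNr -[RHS]col_mx0; congr col_mx.
  apply/matrixP=> i j; rewrite !ord1 [LHS]mxE [X in X + _]mxE [X in _ + X]mxE.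
  by rewrite [X in - X]mxE [RHS]mxE eqxx mulr1n addrC fz0.
have Lz' : L z^-1 by exact: spec_local fP _ Lz fz.
have Uz : z \is a GRing.unit.
  by apply: Dfield; apply: contraNneq fz => ->; rewrite spec0.
eexists; split; first exact: mx_inverse_schur AA' zE Uz.
have Lz'm (i j : 'I_1) : L ((z^-1)%:M i j) by rewrite !ord1 mxE eqxx.
have [Lz'c _] := spec_mulmx Lz'm Lc.
have [Lz'cA' _] := spec_mulmx Lz'c LA'.
have [Ltz' _] := spec_mulmx LA'b Lz'm.
have [Ltz'c _] := spec_mulmx Ltz' Lc.
have [Ltz'cA' _] := spec_mulmx Ltz'c LA'.
apply: spec_dom_block => // i j; rewrite [X in L X]mxE.
- exact: spec_domD.
- exact: spec_domN.
- exact: spec_domN.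
Qed.

End Lifting.

(** * Hook functions as solutions of a unitriangular system *)

Section HookRecursion.
Variables (F : fieldType) (a : int -> F) (D : unitRingType).
Variable phi : {rmorphism Sym F -> D}.

Local Notation S s k := (phi (shifted_Sz a s k)).

Lemma shifted_Sz_neg s k : (k < 0)%R -> shifted_Sz a s k = 0.
Proof. by case: k. Qed.

Lemma shifted_Sz0 s : shifted_Sz a s 0 = 1.
Proof.
rewrite /= /shifted_S falling_coefE big_ord0 subr0 /falling_series big_ord1 /=.
by rewrite scale1r.
Qed.

(** The infinite Jacobi-Trudi array with [b] rows has the entry
    [S_(m-i)^[b-1-i]] in row [i] and column [m].  This is its initial square
    part; a larger array contains it at the bottom of its rows, shifted to the
    right. *)
Definition base_mx b : 'M[D]_b :=
  \matrix_(i, j) S (b%:Z - i.+1%:Z) (j%:Z - i%:Z).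

Lemma base_mx_lt b (i j : 'I_b) : (j < i)%N -> base_mx b i j = 0.
Proof.
by move=> lt_ji; rewrite mxE shifted_Sz_neg ?rmorph0 //; lia.
Qed.

Lemma base_mx_diag b (i : 'I_b) : base_mx b i i = 1.
Proof. by rewrite mxE subrr shifted_Sz0 rmorph1. Qed.

Lemma base_mx_invertible b : mx_invertible (base_mx b).
Proof. exact: unitriangular_invertible (@base_mx_lt b) (@base_mx_diag b). Qed.

Lemma tnth_hook_lift b c (q : 'I_b) : tnth (hook b c) (lift ord_max q) = 1%N.
Proof.
rewrite (tnth_nth 0%N) lift_max /= nth_rcons size_nseq ltn_ord nth_nseq.
by rewrite ltn_ord.
Qed.

Lemma tnth_hook_max b c : tnth (hook b c) ord_max = c.+1.
Proof. by rewrite (tnth_nth 0%N) /= nth_rcons size_nseq ltnn eqxx. Qed.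

Lemma hook_minor b c :
  row' ord0 (col' ord_max (schur_mx a phi (hook b c))) = base_mx b.
Proof.
apply/matrixP=> i j; rewrite !mxE; congr (phi (shifted_Sz a _ _)).
all: by rewrite ?tnth_hook_lift ?lift_max /= ?/bump; lia.
Qed.

Lemma hook_defined b c : quasi_schur_defined a phi (hook b c).
Proof.
rewrite /quasi_schur_defined /quasidet_defined hook_minor.
exact: base_mx_invertible.
Qed.

(** The sign cancels the one in the definition of [quasi_schur]: what is left is
    a bare quasideterminant. *)
Definition signed_hook b c : D := (-1) ^+ b * quasi_schur a phi (hook b c).

Lemma quasi_schur_hook b c :
  quasi_schur a phi (hook b c) = (-1) ^+ b * signed_hook b c.
Proof. by rewrite mulrA -exprD addnn -mul2n exprM sqrrN !expr1n mul1r. Qed.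

Definition signed_hooks b c : 'cV[D]_b := \col_i signed_hook (b - i.+1) c.

Definition column b m : 'cV[D]_b := \col_i S (b%:Z - i.+1%:Z) (m%:Z - i%:Z).

(** The inverse of the minor in the quasideterminant of a hook is that of a base
    matrix, which a solution of the system for the smaller legs eliminates. *)
Lemma signed_hookE b c :
  base_mx b *m signed_hooks b c = column b (b + c) ->
  signed_hook b c = S b (b + c).+1%:Z
    - \sum_(q < b) S b q.+1%:Z * signed_hook (b - q.+1) c.
Proof.
move=> bX; rewrite {1}/signed_hook /quasi_schur mulrA -exprD addnn -mul2n exprM.
rewrite sqrrN !expr1n mul1r /quasidet hook_minor.
have [_ VE] := mxinvP (base_mx_invertible b).
have -> : col ord_max (row' ord0 (schur_mx a phi (hook b c)))
    = base_mx b *m signed_hooks b c.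
  rewrite bX; apply/matrixP=> [[i lt_i] j]; rewrite !mxE.
  congr (phi (shifted_Sz a _ _)).
  by rewrite tnth_hook_max lift0 /=; lia.
rewrite -mulmxA (mulmxA (mxinv _)) VE mul1mx; congr (_ - _).
  rewrite mxE; congr (phi (shifted_Sz a _ _)).
    by rewrite subr0.
  by rewrite tnth_hook_max /=; lia.
rewrite mxE; apply: eq_bigr => q _; rewrite !mxE.
congr (phi (shifted_Sz a _ _) * _).
all: by rewrite ?tnth_hook_lift ?lift_max /= ?/bump; lia.
Qed.

(** The last [b'] rows of this unitriangular system form the system with [b']
    rows, and back-substitution for the unknown above them yields the
    quasideterminant that defines the hook with leg [b']. *)
Lemma base_mx_hooks b c : base_mx b *m signed_hooks b c = column b (b + c).
Proof.
elim/ltn_ind: b => b IHb; apply/matrixP=> i j; rewrite !mxE.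
under eq_bigr => l _ do rewrite !mxE.
have lt_ib := ltn_ord i.
pose E j := S (b%:Z - i.+1%:Z) (j%:Z - i%:Z) * signed_hook (b - j.+1) c.
rewrite -(big_mkord xpredT E) (big_cat_nat (leq0n i) (ltnW lt_ib)) /=.
rewrite big_nat big1 ?add0r => [|l /andP[_ lt_li]]; last first.
  by rewrite /E shifted_Sz_neg ?rmorph0 ?mul0r //; lia.
rewrite big_ltn // {1}/E subrr shifted_Sz0 rmorph1 mul1r.
have -> : \sum_(i.+1 <= l < b) E l = \sum_(q < b - i.+1) E (q + i.+1)%N.
  by rewrite -{1}[i.+1]add0n big_addn big_mkord.
rewrite signed_hookE; last by apply: IHb; lia.
have -> : (b%:Z - i.+1%:Z) = (b - i.+1)%N by lia.
have -> : (b - i.+1 + c).+1%:Z = (b + c)%:Z - i%:Z by lia.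
rewrite -[RHS]addr0 -addrA; congr (_ + _); apply/eqP; rewrite addrC subr_eq0.
apply/eqP/eq_bigr=> q _; rewrite /E.
congr (phi (shifted_Sz a _ _) * signed_hook _ c).
all: lia.
Qed.

Lemma signed_hook_rec b c :
  signed_hook b c = S b (b + c).+1%:Z
    - \sum_(q < b) S b q.+1%:Z * signed_hook (b - q.+1) c.
Proof. exact/signed_hookE/base_mx_hooks. Qed.

End HookRecursion.

(** * Hook matrices at points of the free algebra *)

Lemma subr_subACA (V : zmodType) (x y z t : V) :
  x - y - (z - t) = x - z - (y - t).
Proof.
by rewrite !opprB -!addrA [- y + _]addrCA [- z + _]addrCA [- y - z]addrC.
Qed.

Section Points.
Variables (F : fieldType).

Definition word_value (x : nat -> F) (w : {fmonom nat}) : F :=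
  \prod_(j <- w) x j.

Lemma word_value_morph x : mmorphism (word_value x).
Proof.
by split=> [v w|]; rewrite /word_value ?fmM ?big_cat // fm1 big_nil.
Qed.

HB.instance Definition _ x :=
  monalg.isMultiplicative.Build {fmonom nat} F (word_value x)
    (word_value_morph x).

Definition point (x : nat -> F) : {rmorphism Sym F -> F} :=
  mmap idfun (word_value x).

Lemma point_scale x z u : point x (z *: u) = z * point x u.
Proof. exact: (@mmapZ _ _ _ idfun (word_value x)). Qed.

Lemma point_gen x j : point x (gen_S F j.+1) = x j.
Proof. by rewrite /point /= mmapU /= mul1r /word_value fmU big_seq1. Qed.

Lemma point_epic x : epic_field (point x).
Proof.
split=> [z z0|P Ppsi _ _ _ z]; first by rewrite unitfE.
by rewrite -[z]mulr1 -(rmorph1 (point x)) -point_scale.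
Qed.

Lemma point_falling_coef x b f m :
  point x (falling_coef b f m)
    = point x (f m)
      - \sum_(k < m) inv_falling b k m * point x (falling_coef b f k).
Proof.
rewrite falling_coefE rmorphB rmorph_sum; congr (_ - _).
by apply: eq_bigr => k _; rewrite point_scale.
Qed.

Lemma point_falling_series x b (u : nat -> Sym F) m :
  point x (falling_series b u m)
    = \sum_(k < m.+1) inv_falling b k m * point x (u k).
Proof. by rewrite rmorph_sum; apply: eq_bigr => k _; rewrite point_scale. Qed.

Variable a : int -> F.

(** Both expansions in the definition of [S_k^[s]] are unitriangular, so that it
    is [S_k] plus a linear combination of the [S_j] with [j < k].  Comparing two
    points that agree up to [S_t] isolates the term [S_(t+1)], whose coordinate
    has the index [t]. *)
Lemma point_shifted_S_diff x y t s k :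
  (forall j, (j < t)%N -> x j = y j) -> (k <= t.+1)%N ->
  point y (shifted_Sz a s k%:Z) - point x (shifted_Sz a s k%:Z)
    = (y t - x t) *+ (k == t.+1).
Proof.
move=> eq_xy; rewrite /=; elim/ltn_ind: k => k IHk le_kt.
have genE j : (j <= t.+1)%N ->
    point y (gen_S F j) - point x (gen_S F j) = (y t - x t) *+ (j == t.+1).
  case: j => [|j] le_jt; first by rewrite !rmorph1 subrr.
  rewrite !point_gen eqSS; case: eqP => [-> //|ne_jt].
  by rewrite eq_xy ?subrr //; lia.
rewrite /shifted_S !point_falling_coef !point_falling_series.
rewrite subr_subACA -!sumrB.
rewrite [X in _ - X]big1 => [|j _]; last first.
  rewrite -mulrBr IHk ?(leq_trans (ltnW _) le_kt) //.
  by rewrite (ltn_eqF (leq_trans (ltn_ord j) le_kt)) mulr0.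
rewrite subr0 big_ord_recr /= inv_falling_diag -mulrBr mul1r genE //.
rewrite big1 ?add0r // => j _; rewrite -mulrBr genE.
  by rewrite (ltn_eqF (leq_trans (ltn_ord j) le_kt)) mulr0.
by rewrite ltnW // (leq_trans (ltn_ord j) le_kt).
Qed.

(** In [signed_hook_rec] the products only involve generators of index at most
    [b] and hooks with fewer than [b+c+1] boxes, hence no [S_(b+c+1)]: only the
    leading term does, with coefficient one. *)
Lemma signed_hook_diff x y t b c :
  (forall j, (j < t)%N -> x j = y j) -> (b + c <= t)%N ->
  signed_hook a (point y) b c - signed_hook a (point x) b c
    = (y t - x t) *+ (b + c == t)%N.
Proof.
move=> eq_xy; elim/ltn_ind: b => b IHb le_bct.
rewrite !(signed_hook_rec a _ b c) subr_subACA.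
rewrite (point_shifted_S_diff _ eq_xy) ?ltnS // eqSS -sumrB.
rewrite big1 ?subr0 // => q _; have lt_qb := ltn_ord q.
have le_bt : (b <= t)%N by lia.
have le_qt : (q.+1 <= t.+1)%N := leqW (leq_trans lt_qb le_bt).
have /eqP := point_shifted_S_diff b eq_xy le_qt.
rewrite eqSS (ltn_eqF (leq_trans lt_qb le_bt)) subr_eq0 => /eqP ->.
rewrite -mulrBr IHb; try lia.
have /ltn_eqF -> : (b - q.+1 + c < t)%N by lia.
by rewrite mulr0.
Qed.

Lemma det_corner (R : comNzRingType) (g g' : nat -> nat -> R) m :
  (forall i j, (i <= m)%N -> (j <= m)%N -> (i != m) || (j != m) ->
     g i j = g' i j) ->
  \det (leading g' m.+1)
    = \det (leading g m.+1) + (g' m m - g m m) * \det (leading g m).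
Proof.
move=> eq_g; rewrite !(expand_det_row _ ord_max).
have cofE j : cofactor (leading g' m.+1) ord_max j
              = cofactor (leading g m.+1) ord_max j.
  congr (_ * \det _); apply/matrixP=> p q; rewrite !mxE lift_max eq_g //.
  - by rewrite ltnW.
  - by rewrite -ltnS.
  - by rewrite (ltn_eqF (ltn_ord p)).
rewrite !big_ord_recr /= !cofE !mxE /= -addrA; congr (_ + _).
  apply: eq_bigr => j _; rewrite cofE !mxE eq_g //= ?(ltnW (ltn_ord j)) //.
  by rewrite (ltn_eqF (ltn_ord j)) orbT.
have -> : cofactor (leading g m.+1) ord_max ord_max = \det (leading g m).
  rewrite /cofactor /= addnn -signr_odd odd_double expr0 mul1r; congr (\det _).
  by apply/matrixP=> i j; rewrite !mxE !lift_max.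
by rewrite mulrBl addrC subrK.
Qed.

(** Along a strictly increasing sequence of hooks, the corner of a leading block
    is its only entry to involve the generator of largest index, so a vanishing
    determinant is repaired by moving that coordinate of the point, which leaves
    the smaller leading blocks alone. *)
Lemma regular_point (b c : nat -> nat) m :
  (forall i j, (i < j < m)%N -> (b i < b j)%N /\ (c i < c j)%N) ->
  exists x, forall k, (k <= m)%N ->
    leading (fun i j => quasi_schur a (point x) (hook (b i) (c j))) k
      \in unitmx.
Proof.
pose G x i j := quasi_schur a (point x) (hook (b i) (c j)).
elim: m => [|m IHm] bc_lt.
  exists (fun=> 0) => k; rewrite leqn0 => /eqP->.
  by rewrite unitmxE det_mx00 unitr1.
have [|x Ux] := IHm.
  by move=> i j /andP[lt_ij lt_jm]; apply: bc_lt; rewrite lt_ij leqW.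
have [Um|Um] := boolP (leading (G x) m.+1 \in unitmx).
  by exists x => k; rewrite leq_eqVlt => /predU1P[-> //|]; exact: Ux.
(* The generator of largest index in the corner entry is S_(t+1). *)
pose t := (b m + c m)%N.
pose y j := x j + (j == t)%:R.
have eq_xy j : (j < t)%N -> x j = y j.
  by move=> lt_jt; rewrite /y ltn_eqF ?addr0.
have GD i j : (i <= m)%N -> (j <= m)%N ->
    G y i j - G x i j = (-1) ^+ b i * ((i == m) && (j == m))%:R.
  move=> le_im le_jm.
  have [le_b lt_b]: (b i <= b m)%N /\ ((i < m)%N -> (b i < b m)%N).
    move: le_im; rewrite leq_eqVlt => /predU1P[-> |lt_im].
      by rewrite ltnn.
    by have [|] := bc_lt i m; rewrite ?lt_im //= => lt _; rewrite ltnW.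
  have [le_c lt_c]: (c j <= c m)%N /\ ((j < m)%N -> (c j < c m)%N).
    move: le_jm; rewrite leq_eqVlt => /predU1P[-> |lt_jm].
      by rewrite ltnn.
    by have [|] := bc_lt j m; rewrite ?lt_jm //= => _ lt; rewrite ltnW.
  rewrite /G !quasi_schur_hook -mulrBr (signed_hook_diff eq_xy) ?leq_add //.
  congr (_ * _); rewrite {1}/y eqxx addrC addKr; congr (_ *+ _).
  congr nat_of_bool; rewrite /t.
  have [->|ne_im] := eqVneq i m; have [->|ne_jm] := eqVneq j m;
    rewrite ?eqxx //=.
  - by have := lt_c; lia.
  - by have := lt_b; lia.
  - by have := lt_b; lia.
exists y => k; rewrite leq_eqVlt => /predU1P[-> |lt_km].
  rewrite unitmxE unitfE (@det_corner _ (G x)); last first.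
    move=> i j le_im le_jm ne_ijm; apply/esym/eqP; rewrite -subr_eq0 GD //.
    by rewrite -negb_and in ne_ijm; rewrite (negPf ne_ijm) mulr0.
  move: Um; rewrite unitmxE unitfE negbK => /eqP ->.
  rewrite add0r GD // eqxx mulr1 mulf_neq0 ?signr_eq0 //.
  by rewrite -unitfE -unitmxE Ux.
have -> : leading (fun i j => quasi_schur a (point y) (hook (b i) (c j))) k
        = leading (G x) k; last exact: Ux.
apply/matrixP=> i j; rewrite !mxE; apply/eqP; rewrite -subr_eq0.
have lt_im : (i < m)%N by apply: leq_trans (ltn_ord i) _.
have lt_jm : (j < m)%N by apply: leq_trans (ltn_ord j) _.
by rewrite GD ?(ltnW lt_im) ?(ltnW lt_jm) // (ltn_eqF lt_im) mulr0.
Qed.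

End Points.

(** * Invertibility of hook matrices over the skew field *)

Section HookMatrix.
Variables (F : fieldType) (a : int -> F) (D : unitRingType).
Variable phi : {rmorphism Sym F -> D}.

Lemma spec_signed_hook x (L : D -> Prop) (f : D -> F) b c :
  specialization phi (point x) L f ->
  L (signed_hook a phi b c) /\
  f (signed_hook a phi b c) = signed_hook a (point x) b c.
Proof.
move=> fP; elim/ltn_ind: b => b IHb; rewrite !(signed_hook_rec _ _ b c).
have LS k : L (phi (shifted_Sz a b k)) by exact: spec_dom_base fP _.
have IH (q : 'I_b) := IHb (b - q.+1)%N (ltac:(have := ltn_ord q; lia)).
have Lt (q : 'I_b) :
    L (phi (shifted_Sz a b q.+1) * signed_hook a phi (b - q.+1) c).
  by apply: (spec_dom_mul fP) => //; case: (IH q).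
have [Lsum fsum] := spec_sum fP (index_enum _) xpredT Lt.
split; first exact: (spec_dom_sub fP).
rewrite (specB fP) // (spec_base fP) fsum; congr (_ - _); apply: eq_bigr => q _.
have [Lq fq] := IH q.
by rewrite (spec_mul fP) // (spec_base fP) fq.
Qed.

(** Specialize to a point where the leading blocks are nonsingular, and lift
    their invertibility back. *)
Lemma hook_matrix_invertible (b c : nat -> nat) m :
  universal_field_of_fractions phi ->
  (forall i j, (i < j < m)%N -> (b i < b j)%N /\ (c i < c j)%N) ->
  mx_invertible (leading (fun i j => quasi_schur a phi (hook (b i) (c j))) m).
Proof.
move=> phi_univ bc_lt.
have [x Ux] := regular_point a bc_lt.
have [L [f fP]] := ufrac_universal phi_univ (point_epic x).
have field_D := epic_field_axiom (ufrac_epic phi_univ).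
have hookP i j : L (quasi_schur a phi (hook (b i) (c j))) /\
    f (quasi_schur a phi (hook (b i) (c j)))
      = quasi_schur a (point x) (hook (b i) (c j)).
  have [Lh fh] := spec_signed_hook (b i) (c j) fP.
  rewrite !quasi_schur_hook -(rmorph_sign phi) -(rmorph_sign (point x)).
  have Ls := spec_dom_base fP ((-1) ^+ b i).
  split; first exact: (spec_dom_mul fP).
  by rewrite (spec_mul fP) // (spec_base fP) fh.
have [|k le_km|V [MV _]] := @lift_leading_inverse _ _ _ _ _ field_D _ _ fP
  (fun i j => quasi_schur a phi (hook (b i) (c j))) m.
- by move=> i j; case: (hookP i j).
- suff -> : leading (fun i j => f (quasi_schur a phi (hook (b i) (c j)))) k
    = leading (fun i j => quasi_schur a (point x) (hook (b i) (c j))) k.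
    exact: Ux.
  by apply/matrixP=> i j; rewrite !mxE; case: (hookP i j).
- by exists V.
Qed.

End HookMatrix.

(** * Frobenius coordinates and beta-numbers of a partition *)

(** The elements of an initial segment that satisfy an antitone predicate form
    an initial segment, which their number determines. *)
Lemma count_iota_antitone (p : pred nat) N d :
  (forall i j, (i <= j)%N -> p j -> p i) -> (d < N)%N ->
  (d < count p (iota 0 N))%N = p d.
Proof.
move=> p_anti lt_dN; apply/idP/idP.
  apply: contraTT => Npd; rewrite -leqNgt.
  have -> : N = (d + (N - d))%N by lia.
  rewrite iotaD count_cat add0n.
  have -> : count p (iota d (N - d)) = 0%N.
    apply/eqP; rewrite -leqn0 leqNgt -has_count; apply/hasPn => j.
    by rewrite mem_iota => /andP[le_dj _]; apply: contra Npd; exact: p_anti.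
  by rewrite addn0 -[X in (_ <= X)%N](size_iota 0 d) count_size.
move=> pd; have -> : N = (d.+1 + (N - d.+1))%N by lia.
rewrite iotaD count_cat; apply: leq_trans (leq_addr _ _).
suff : all p (iota 0 d.+1) by rewrite all_count => /eqP ->; rewrite size_iota.
apply/allP=> j; rewrite mem_iota add0n ltnS => /andP[_ le_jd].
exact: p_anti pd.
Qed.

Section Frobenius.
Variables (n : nat) (lam : n.+1.-tuple nat).

Lemma tnth_row_len (q : 'I_n.+1) : tnth lam q = row_len lam (n - q).
Proof.
have lt_q := ltn_ord q.
rewrite /row_len nth_rev size_tuple; last by lia.
rewrite (tnth_nth 0%N); congr nth; lia.
Qed.

Hypothesis lam_part : is_partition lam.

Lemma row_len_anti i j : (i <= j)%N -> (row_len lam j <= row_len lam i)%N.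
Proof.
move=> le_ij; have [le_nj|lt_jn] := leqP n.+1 j.
  by rewrite /row_len nth_default // size_rev size_tuple.
rewrite /row_len !nth_rev ?size_tuple //; last by lia.
case/andP: lam_part => lam_sorted _.
apply: (sorted_leq_nth leq_trans leqnn 0%N lam_sorted);
  rewrite ?inE ?size_tuple; lia.
Qed.

Lemma row_len_gt0 i : (i <= n)%N -> (0 < row_len lam i)%N.
Proof.
move=> le_in; case/andP: lam_part => _ /all_nthP pos.
by rewrite /row_len nth_rev ?size_tuple //; apply: pos; rewrite size_tuple; lia.
Qed.

(** Both sides say that the box in row [d] and column [j] is in the diagram. *)
Lemma conjugate j d :
  (d <= n)%N -> (j < row_len lam d)%N = (d < col_len lam j)%N.
Proof.
move=> le_dn; have -> : col_len lam j
    = count (fun d => j < row_len lam d)%N (iota 0 n.+1).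
  rewrite /col_len -count_rev -[rev lam](mkseq_nth 0%N) count_map.
  by rewrite size_rev size_tuple.
rewrite count_iota_antitone // => i l le_il lt_jl.
exact: leq_trans lt_jl (row_len_anti le_il).
Qed.

Lemma col_len_le j : (col_len lam j <= n.+1)%N.
Proof. by have := count_size (ltn j) lam; rewrite size_tuple. Qed.

Lemma col_len_anti i j : (i <= j)%N -> (col_len lam j <= col_len lam i)%N.
Proof.
move=> le_ij; case Ec: (col_len lam j) => [//|d].
have le_dn : (d <= n)%N by rewrite -ltnS -Ec col_len_le.
by rewrite -conjugate // (leq_ltn_trans le_ij) // conjugate // Ec.
Qed.

Lemma col_len0 : col_len lam 0 = n.+1.
Proof. by apply/eqP; rewrite eqn_leq col_len_le -conjugate ?row_len_gt0. Qed.

Variable k : nat.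
Hypothesis lam_diag : diag_len lam = k.+1.

Lemma diag_len_le : (k <= n)%N.
Proof.
have := count_size (fun d => d < row_len lam d)%N (iota 0 (size lam)).
by rewrite -/(diag_len lam) lam_diag size_iota size_tuple ltnS.
Qed.

Lemma diag_row_len d : (d <= n)%N -> (d < row_len lam d)%N = (d <= k)%N.
Proof.
move=> le_dn; rewrite -[RHS]ltnS -lam_diag /diag_len size_tuple.
rewrite count_iota_antitone // => i j le_ij lt_j.
exact: leq_trans (leq_ltn_trans le_ij lt_j) (row_len_anti le_ij).
Qed.

End Frobenius.

Section Giambelli.
Variables (n : nat) (lam : n.+1.-tuple nat).
Hypothesis lam_part : is_partition lam.
Variable k : nat.
Hypothesis lam_diag : diag_len lam = k.+1.

(** The hooks are listed from the innermost to the outermost, as in the Frobenius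
    notation of the statement. *)
Definition hook_leg i := leg lam (k - i).
Definition hook_arm i := arm lam (k - i).

Lemma hook_lt i j : (i < j < k.+1)%N ->
  (hook_leg i < hook_leg j)%N /\ (hook_arm i < hook_arm j)%N.
Proof.
move=> /andP[lt_ij le_jk]; have le_kn := diag_len_le lam_diag.
have le_d : (k - j <= k - i)%N by lia.
have := row_len_anti lam_part le_d; have := col_len_anti lam_part le_d.
have := diag_row_len lam_part lam_diag (d := (k - i)%N) ltac:(lia).
have := conjugate lam_part (k - i) (d := (k - i)%N) ltac:(lia).
rewrite /hook_leg /hook_arm /leg /arm; lia.
Qed.

(** The beta-numbers [lam_q + q]: column [q] of the Jacobi-Trudi matrix of [lam]
    is the column of this index in the infinite Jacobi-Trudi array. *)
Definition beta_number (q : nat) := (row_len lam (n - q) + q)%N.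

Lemma beta_number_small q : (q < n - k)%N -> (beta_number q <= n)%N.
Proof.
move=> lt_q; have := diag_row_len lam_part lam_diag (d := (n - q)%N) ltac:(lia).
rewrite /beta_number; lia.
Qed.

Lemma beta_number_large p : (p <= k)%N ->
  beta_number (n - k + p) = (n.+1 + hook_arm p)%N.
Proof.
move=> le_pk; have le_kn := diag_len_le lam_diag.
rewrite /beta_number /hook_arm /arm.
have -> : (n - (n - k + p) = k - p)%N by lia.
have := diag_row_len lam_part lam_diag (d := (k - p)%N) ltac:(lia).
lia.
Qed.

(** The order of the rows that reveals the block structure: the beta-numbers of
    the first [n - k] columns, then the rows that these miss.  That this exhausts
    [0, ..., n] follows from injectivity by counting. *)
Definition row_index (i : 'I_((n - k) + k.+1)) : nat :=
  match split i with
  | inl q => beta_number q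
  | inr p => n - hook_leg p
  end.

Lemma hook_leg_le p : (hook_leg p <= n)%N.
Proof. have := col_len_le lam (k - p); rewrite /hook_leg /leg; lia. Qed.

Lemma row_index_le i : (row_index i <= n)%N.
Proof.
rewrite /row_index; case: splitP => [q _|p _]; last by rewrite leq_subr.
exact: beta_number_small.
Qed.

(** A beta-number and a row index of the second kind are compared by asking
    whether the box in row [n - q] and column [k - p] is in the diagram. *)
Lemma beta_number_neq (q p : nat) : (q < n - k)%N -> (p <= k)%N ->
  beta_number q <> (n - hook_leg p)%N.
Proof.
move=> lt_q le_pk; have le_kn := diag_len_le lam_diag.
have := conjugate lam_part (k - p) (d := (n - q)%N) ltac:(lia).
have := conjugate lam_part (k - p) (d := (k - p)%N) ltac:(lia).
have := diag_row_len lam_part lam_diag (d := (k - p)%N) ltac:(lia).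
have := col_len_le lam (k - p).
rewrite /beta_number /hook_leg /leg; lia.
Qed.

Lemma beta_number_lt q q' :
  (q < q' <= n)%N -> (beta_number q < beta_number q')%N.
Proof.
move=> lt_q; have := @row_len_anti _ _ lam_part (n - q') (n - q) ltac:(lia).
rewrite /beta_number; lia.
Qed.

Lemma row_index_inj : injective row_index.
Proof.
have le_kn := diag_len_le lam_diag.
move=> i j; rewrite -[i]splitK -[j]splitK /row_index !unsplitK.
case: (split i) => i'; case: (split j) => j' /= eq_ij.
- congr lshift; apply/val_inj => /=.
  have lti := ltn_ord i'; have ltj := ltn_ord j'.
  case: (ltngtP i' j') => // lt_ij.
    have := @beta_number_lt i' j' ltac:(lia); lia.
  have := @beta_number_lt j' i' ltac:(lia); lia.
- by case: (@beta_number_neq i' j' (ltn_ord i') (ltn_ord j') eq_ij).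
- by case: (@beta_number_neq j' i' (ltn_ord j') (ltn_ord i') (esym eq_ij)).
- congr rshift; apply/val_inj => /=.
  have lti := ltn_ord i'; have ltj := ltn_ord j'.
  have := hook_leg_le i'; have := hook_leg_le j'.
  case: (ltngtP i' j') => // lt_ij.
    have [] := @hook_lt i' j' ltac:(lia); lia.
  have [] := @hook_lt j' i' ltac:(lia); lia.
Qed.

Lemma hook_leg_max : hook_leg k = n.
Proof. by rewrite /hook_leg subnn /leg (col_len0 lam_part) subn1. Qed.

(** * From the Jacobi-Trudi matrix to the Giambelli matrix *)

Variables (F : fieldType) (a : int -> F) (D : unitRingType).
Variable phi : {rmorphism Sym F -> D}.

(** The Jacobi-Trudi matrix of [lam] in the basis of the first [n.+1] columns of
    the infinite array: small beta-numbers are columns of that basis, and the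
    coordinates of the other columns are hook functions. *)
Definition reduced_mx : 'M[D]_n.+1 :=
  \matrix_(i, q) if (q < n - k)%N then (i == beta_number q :> nat)%:R
                 else signed_hook a phi (n - i) (hook_arm (q - (n - k))).

Lemma schur_mx_reduced :
  schur_mx a phi lam = base_mx a phi n.+1 *m reduced_mx.
Proof.
have le_kn := diag_len_le lam_diag.
apply/matrixP=> i q; rewrite mxE.
have -> : n%:Z - i%:Z = n.+1%:Z - i.+1%:Z by lia.
have -> : (tnth lam q)%:Z + q%:Z = (beta_number q)%:Z.
  by rewrite tnth_row_len.
have lt_q := ltn_ord q; case: (ltnP q (n - k)) => [lt_qr|le_rq].
  have le_mn := beta_number_small lt_qr.
  rewrite !mxE (bigD1 (Ordinal (le_mn : (_ < n.+1)%N))) //= !mxE /= lt_qr eqxx.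
  rewrite mulr1 big1 ?addr0 // => j ne_j; rewrite !mxE lt_qr.
  by move: ne_j; rewrite -val_eqE /= => /negPf->; rewrite mulr0.
have qE : nat_of_ord q = (n - k + (q - (n - k)))%N by lia.
rewrite {1}qE beta_number_large; last by lia.
have /matrixP/(_ i 0) := base_mx_hooks a phi n.+1 (hook_arm (q - (n - k))).
by rewrite !mxE => <-; apply: eq_bigr => j _; rewrite !mxE ltnNge le_rq subSS.
Qed.

Definition signed_hook_mx : 'M[D]_k.+1 :=
  leading (fun i j => signed_hook a phi (hook_leg i) (hook_arm j)) k.+1.

Lemma block_reduced (f g : 'I_(n - k + k.+1) -> 'I_n.+1) :
  (forall i, f i = row_index i :> nat) -> (forall i, g i = i :> nat) ->
  exists X, mxsub f g reduced_mx = block_mx 1%:M X 0 signed_hook_mx.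
Proof.
move=> fE gE; exists (ursubmx (mxsub f g reduced_mx)).
have le_kn := diag_len_le lam_diag.
rewrite -[LHS]submxK; congr block_mx.
- apply/matrixP=> i j; rewrite !mxE fE gE /row_index /= ltn_ord.
  rewrite (unsplitK (inl i)); congr (_%:R); congr nat_of_bool.
  apply/eqP/eqP => [eq_ij|-> //]; apply/val_inj => /=.
  have lti := ltn_ord i; have ltj := ltn_ord j.
  case: (ltngtP i j) => // lt_ij.
    have := @beta_number_lt i j ltac:(lia); lia.
  have := @beta_number_lt j i ltac:(lia); lia.
- apply/matrixP=> i j; rewrite !mxE fE gE /row_index /= ltn_ord.
  rewrite (unsplitK (inr i)); case: eqP => // /esym eq_ij.
  by case: (@beta_number_neq j i (ltn_ord j) (ltn_ord i) eq_ij).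
- apply/matrixP=> i j; rewrite !mxE fE gE /row_index /=.
  rewrite ltnNge leq_addr /= (unsplitK (inr i)) addKn subKn //.
  exact: hook_leg_le.
Qed.

Definition giambelli_leading m : 'M[D]_m :=
  leading (fun i j => quasi_schur a phi (hook (hook_leg i) (hook_arm j))) m.

(** The signs multiply the Giambelli matrix on the left by a diagonal matrix,
    whose last entry has the exponent [n], the outermost leg. *)
Lemma signed_hook_mx_inverse V : mx_inverse (giambelli_leading k.+1) V ->
  exists2 Y, mx_inverse signed_hook_mx Y
           & Y ord_max ord_max = V ord_max ord_max * (-1) ^+ n.
Proof.
move=> GV; pose s : 'rV[D]_k.+1 := \row_i (-1) ^+ hook_leg i.
have ss : diag_mx s *m diag_mx s = 1%:M.
  rewrite mul_diag_mx; apply/matrixP=> i j; rewrite !mxE mulrnAr.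
  by rewrite -exprD addnn -mul2n exprM sqrrN !expr1n.
exists (V *m diag_mx s); last by rewrite mul_mx_diag !mxE hook_leg_max.
rewrite (_ : signed_hook_mx = diag_mx s *m giambelli_leading k.+1).
  by apply: mx_inverse_mul.
by rewrite mul_diag_mx; apply/matrixP=> i j; rewrite !mxE.
Qed.

(** The corner of the inverse Jacobi-Trudi matrix is, up to a sign, that of the
    inverse Giambelli matrix: rows and columns only get permuted, and the base
    matrix fixes the first basis vector. *)
Lemma schur_mx_inverse V : mx_inverse (giambelli_leading k.+1) V ->
  exists2 W, mx_inverse (schur_mx a phi lam) W
           & W ord_max ord0 = V ord_max ord_max * (-1) ^+ n.
Proof.
move=> /signed_hook_mx_inverse[Y SY <-].
have le_kn := diag_len_le lam_diag.
have eqN : (n - k + k.+1 = n.+1)%N by lia.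
pose f i : 'I_n.+1 := Ordinal (row_index_le i : (_ < n.+1)%N).
pose g : 'I_(n - k + k.+1) -> 'I_n.+1 := cast_ord eqN.
pose g' : 'I_n.+1 -> 'I_(n - k + k.+1) := cast_ord (esym eqN).
have [||f' fK f'K] := @inj_card_bij _ _ f.
- by move=> i j /(congr1 val); exact: row_index_inj.
- by rewrite !card_ord eqN.
have gK : cancel g g' by exact: cast_ordK.
have g'K : cancel g' g by exact: cast_ordKV.
have [X TE] := @block_reduced f g (fun=> erefl) (fun=> erefl).
have I1 : mx_inverse (1%:M : 'M[D]_(n - k)) 1%:M by split; rewrite mulmx1.
have := mx_inverse_ublock X I1 SY; rewrite -TE.
move=> /(mx_inverse_mxsub fK f'K gK g'K) RW.
have [E BE] := base_mx_invertible a phi n.+1.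
rewrite schur_mx_reduced; eexists; first exact: mx_inverse_mul BE RW.
have E0 : E *m delta_mx ord0 0 = delta_mx ord0 0 :> 'cV_n.+1.
  rewrite -[RHS]mul1mx -BE.2 -mulmxA; congr (_ *m _); rewrite -colE.
  apply/matrixP=> i j; rewrite ord1 [RHS]mxE [LHS]mxE.
  have [->|ne_i0] := eqVneq i ord0; first by rewrite base_mx_diag.
  by rewrite base_mx_lt //= lt0n.
have f'0 : f' ord0 = rshift (n - k) ord_max.
  rewrite -[RHS]fK; congr f'; apply/val_inj => /=.
  by rewrite /row_index (unsplitK (inr ord_max)) /= hook_leg_max subnn.
have g'max : g' ord_max = rshift (n - k) ord_max by apply/val_inj => /=; lia.
set W := mxsub g' f' _; have -> : (W *m E) ord_max ord0
    = (col ord0 (W *m E)) ord_max 0 by rewrite [RHS]mxE.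
by rewrite colE -mulmxA E0 -colE [LHS]mxE [LHS]mxE f'0 g'max block_mxEdr.
Qed.

End Giambelli.

Unset Implicit Arguments.

Theorem proposition46 (F : fieldType) (charF0 : [pchar F] =i pred0)
    (a : int -> F)
    (D : unitRingType) (phi : {rmorphism Sym F -> D})
    (phi_univ : universal_field_of_fractions phi)
    (n : nat) (lam : n.+1.-tuple nat) (lam_part : is_partition lam)
    (k : nat) (beta alpha : k.+1.-tuple nat)
    (lam_frob : frobenius lam beta alpha) :
  [/\ quasi_schur_defined a phi lam,
      forall p q : 'I_k.+1,
        quasi_schur_defined a phi (hook (tnth beta p) (tnth alpha q)),
      quasidet_defined (giambelli_mx a phi beta alpha) ord_max ord_max
    & quasi_schur a phi lam
      = quasidet (giambelli_mx a phi beta alpha) ord_max ord_max].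
Proof.
have [lam_diag betaE alphaE] := lam_frob.
have field_D := epic_field_axiom (ufrac_epic phi_univ).
have leading_inv m : (m <= k.+1)%N ->
    mx_invertible (giambelli_leading lam k a phi m).
  move=> le_m; apply: hook_matrix_invertible => // i j /andP[lt_ij lt_jm].
  apply: (hook_lt lam_part lam_diag).
  by rewrite lt_ij (leq_trans lt_jm le_m).
have GE : giambelli_mx a phi beta alpha = giambelli_leading lam k a phi k.+1.
  by apply/matrixP=> i j; rewrite !mxE betaE alphaE.
have minorE : row' ord_max (col' ord_max (giambelli_mx a phi beta alpha))
    = giambelli_leading lam k a phi k.
  by rewrite GE; apply/matrixP=> i j; rewrite !mxE !lift_max.
have G_def : quasidet_defined (giambelli_mx a phi beta alpha) ord_max ord_max.
  by rewrite /quasidet_defined minorE; exact: leading_inv.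
have [V GV] := leading_inv _ (leqnn _).
have V_unit : V ord_max ord_max \is a GRing.unit.
  by apply: field_D; rewrite -GE in GV; exact: inverse_entry_neq0 GV G_def.
have [W SW We] := schur_mx_inverse lam_part lam_diag GV.
have W_unit : W ord_max ord0 \is a GRing.unit.
  by rewrite We unitrMl // unitrX // unitrN1.
have [S_def S_val] := quasidet_inverse SW W_unit.
have [_ G_val] := quasidet_inverse GV V_unit.
split=> // [p q|]; first exact: hook_defined.
rewrite /quasi_schur S_val We GE G_val invrM ?unitrX ?unitrN1 //.
by rewrite mulrA divrr ?mul1r // unitrX ?unitrN1.
Qed.
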